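(* Let $H$ be a finite dimensional complex Hilbert space, let $u\in H$ be a unit vector, let $p\ge 1$ be an integer, and let $\tau:\mathcal{B}(H)\to\mathcal{B}(H)$ be a unital completely positive map such that $\tau^p(X)=\langle u,Xu\rangle I$ for all $X\in\mathcal{B}(H)$. Set $H_0=\{x\in H:\langle x,u\rangle=0\}$, so that $H=\mathbb{C}u\oplus H_0$. Let $\alpha:\mathcal{B}(H_0)\to\mathcal{B}(H_0)$ be the compression of $\tau$ to $\mathcal{B}(H_0)$. Then $\alpha$ is a nilpotent completely positive map of order at most $p$ (that is, $\alpha^p=0$).
   Context: $\mathcal{B}(H)$ is the algebra of all linear maps on $H$, $I$ is the identity, and inner products are anti-linear in the first variable. $\tau^p$ is the $p$-fold composition of $\tau$ with itself. The compression of $\tau$ to $\mathcal{B}(H_0)$ is the map $\alpha(X)=P\,\tau\!\left(\begin{pmatrix}0&0\\0&X\end{pmatrix}\right)\Big|_{H_0}$ for $X\in\mathcal{B}(H_0)$, where the block matrix is with respect to $H=\mathbb{C}u\oplus H_0$ and $P$ is the orthogonal projection of $H$ onto $H_0$. A linear map $A$ is nilpotent of order $q$ if $A^q=0$ and $q$ is the smallest such number. *)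

(* Defs.v *)
From HB Require Import structures.
From mathcomp Require Import all_boot all_order all_algebra.
From mathcomp Require Import complex reals.

Set Implicit Arguments.
Unset Strict Implicit.
Unset Printing Implicit Defensive.

Import Order.TTheory GRing.Theory Num.Theory.

Local Open Scope ring_scope.

(* A finite dimensional complex Hilbert space is a [vectType C] with a form
   [h : {dot H for Num.conj}] (completeness is automatic), and B(H) is
   ['End(H)].  Forms of sesquilinear.v are linear in the FIRST variable, so the
   arguments are swapped to get <x, y> anti-linear in the first one. *)
Definition inner (C : numClosedFieldType) (H : vectType C)
  (h : {dot H for Num.conj}) (x y : H) : C := h y x.

Section SubForm.
Variables (C : numClosedFieldType) (H : vectType C).
Variables (h : {dot H for Num.conj}) (V : {vspace H}).

Definition sub_form (x y : subvs_of V) : C := h (vsval x) (vsval y).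

Fact sub_form_bilinear :
  bilinear_for (GRing.Scale.Law.clone _ _ *%R _)
    (GRing.Scale.Law.clone _ _ (Num.conj \; *%R) _) sub_form.
Proof.
by split=> [y a x x'|x a y y'] /=; rewrite /sub_form linearP /= ?linearPl.
Qed.
HB.instance Definition _ :=
  bilinear_isBilinear.Build C _ _ _ _ _ sub_form sub_form_bilinear.

Fact sub_form_hermitian x y :
  sub_form x y = (-1) ^+ false * Num.conj (sub_form y x).
Proof. exact: hermC. Qed.
HB.instance Definition _ :=
  isHermitianSesquilinear.Build C _ false Num.conj sub_form sub_form_hermitian.

Fact sub_form_gt0 x : x != 0 -> 0 < sub_form x x.
Proof.
by move=> x0; apply: neq0_dnorm_gt0; apply: contra x0 => /eqP x0; apply/eqP/val_inj.
Qed.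
HB.instance Definition _ := isDotProduct.Build C _ sub_form sub_form_gt0.

(* B(V) acts on V with the inner product of H restricted to V. *)
Definition sub_dot : {dot (subvs_of V) for Num.conj} := sub_form.

End SubForm.

Section CompletePositivity.
Variables (C : numClosedFieldType) (H : vectType C).
Variable h : {dot H for Num.conj}.

(* A k x k matrix of operators acts on the Hilbert sum of k copies of H by
   (A x)_i = \sum_j A_ij x_j; it is positive when <x, A x> >= 0 for all x. *)
Definition positive_opmx k (A : 'M['End(H)]_k) : Prop :=
  forall x : 'I_k -> H, 0 <= \sum_i inner h (x i) (\sum_j A i j (x j)).

Definition completely_positive (Phi : {linear 'End(H) -> 'End(H)}) : Prop :=
  forall k (A : 'M['End(H)]_k),
    positive_opmx A -> positive_opmx (map_mx Phi A).

End CompletePositivity.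

Section Compression.
Variables (C : numClosedFieldType) (H : vectType C).
Variables (h : {dot H for Num.conj}) (V : {vspace H}).

Definition incl : 'Hom(subvs_of V, H) := linfun vsval.

Definition orth_proj : 'Hom(H, subvs_of V) :=
  (linfun (vsproj V) \o daddv_pi V (orthov h V))%VF.

(* The block matrix (0 0; 0 X) with respect to the decomposition of H as the
   sum of the orthogonal complement of V and V. *)
Definition corner (X : 'End(subvs_of V)) : 'End(H) :=
  (incl \o X \o orth_proj)%VF.

Definition compression (tau : 'End(H) -> 'End(H))
  (X : 'End(subvs_of V)) : 'End(subvs_of V) :=
  (orth_proj \o tau (corner X) \o incl)%VF.

Fact compression_is_linear (tau : {linear 'End(H) -> 'End(H)}) :
  linear (compression tau).
Proof.
move=> a X Y; rewrite /compression.
have ->: corner (a *: X + Y) = a *: corner X + corner Y.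
  by rewrite /corner comp_lfunDr comp_lfunDl -comp_lfunZr -comp_lfunZl.
by rewrite linearP comp_lfunDr comp_lfunDl -comp_lfunZr -comp_lfunZl.
Qed.
HB.instance Definition _ (tau : {linear 'End(H) -> 'End(H)}) :=
  GRing.isLinear.Build C _ _ _ (compression tau) (compression_is_linear tau).

Lemma cap_orthov : (V :&: orthov h V)%VS = 0%VS.
Proof.
apply/eqP; rewrite -subv0; apply/subvP=> v /memv_capP[vV /mem_orthovP vO].
rewrite memv0; apply/negPn/negP => /(neq0_dnorm_gt0 (s := h)).
by rewrite vO // ltxx.
Qed.

Lemma orth_proj_id (y : subvs_of V) : orth_proj (vsval y) = y.
Proof.
rewrite /orth_proj comp_lfunE lfunE /= daddv_pi_id ?vsvalK ?subvsP //.
exact: cap_orthov.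
Qed.

Lemma orth_proj_orthov x : x \in orthov h V -> orth_proj x = 0.
Proof.
move=> xO; rewrite /orth_proj comp_lfunE lfunE /=.
have xS : x \in (V + orthov h V)%VS by apply: subvP xO; apply: addvSr.
have := daddv_pi_add cap_orthov xS.
rewrite [X in _ + X]daddv_pi_id 1?capvC ?cap_orthov // => /(canRL (addrK _)).
by rewrite subrr => ->; rewrite linear0.
Qed.

Lemma corner_sub X (y : subvs_of V) : corner X (vsval y) = vsval (X y).
Proof. by rewrite /corner 2!comp_lfunE orth_proj_id lfunE. Qed.

Lemma corner_orthov X x : x \in orthov h V -> corner X x = 0.
Proof. by move=> xO; rewrite /corner 2!comp_lfunE orth_proj_orthov ?linear0. Qed.

End Compression.

(* On the zero space the order is 0, since f^0 = id is then zero. *)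
Definition nilpotent_of_order (V : zmodType) (f : V -> V) (q : nat) : Prop :=
  (forall x, iter q f x = 0) /\
  (forall r, (forall x, iter r f x = 0) -> (q <= r)%N).

(* Main.v *)
(** The vector state [omega X = <u, X u>] is invariant under [tau], because
    [tau (omega X I) = omega X I] is also [tau^(p+1) X = omega (tau X) I].  If
    [X u = 0], then applying complete positivity to the Gram matrix
    [[I, X], [X^*, X^* X]], whose lower right entry is annihilated by [omega],
    forces [tau X u = 0] and [<u, tau (X^* ) y> = 0].  Hence [tau] maps the
    corner B(H_0) into itself, [alpha] is the restriction of [tau] to it, and
    [alpha^p X = omega X I = 0] there. *)
Require Import Defs.
From HB Require Import structures.
From mathcomp Require Import all_boot all_order all_algebra.
From mathcomp Require Import complex boolp reals.

Set Implicit Arguments.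
Unset Strict Implicit.
Unset Printing Implicit Defensive.

Import Order.TTheory GRing.Theory Num.Theory.

Local Open Scope ring_scope.

(** Replacing [c] by a real multiple rescales the real number [c * b + c^* * d], so a nonzero value
    could be made arbitrarily negative. It is thus always zero; [c = 'i] gives [b = d] and [c = 1]
    gives [b + d = 0]. *)
Lemma affine_ge0_eq0 (C : numClosedFieldType) (a b d : C) :
  (forall c, 0 <= a + (c * b + c^* * d)) -> b = 0 /\ d = 0.
Proof.
move=> pos.
have a_ge0 : 0 <= a by have := pos 0; rewrite conjC0 !mul0r !addr0.
have lin0 c : c * b + c^* * d = 0.
  set f := c * b + c^* * d; apply: contraTeq isT => f0.
  have f_real : f \is Num.real.
    by rewrite -(addKr a f) rpredD ?rpredN ?ger0_real ?pos.
  (* Chosen so that [a + t * f = -1]. *)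
  pose t : C := - (a + 1) / f.
  have t_real : t \is Num.real.
    by rewrite realM ?realV ?realN // ger0_real ?addr_ge0.
  have := pos (t * c); rewrite rmorphM /= (conj_Creal t_real) -!(mulrA t) -mulrDr.
  by rewrite -/f divfK // opprD addrA subrr sub0r oppr_ge0 ler10.
have := lin0 1; have := lin0 'i.
rewrite conjCi conjC1 mulNr -mulrBr => /eqP.
rewrite mulf_eq0 (negPf (neq0Ci _)) /= subr_eq0 => /eqP->.
by rewrite !mul1r -mulr2n => /eqP; rewrite mulrn_eq0 /= => /eqP->.
Qed.

Section Adjoint.
Variables (C : numClosedFieldType) (H : vectType C).
Variable h : {dot H for Num.conj}.

Let hC x y : h x y = (h y x)^*.
Proof. by rewrite hermC expr0 mul1r. Qed.

(** The Gram map of a basis is injective, since a vector orthogonal to the whole basis has zero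
    norm, hence surjective by dimension. A preimage of the vector with coordinates [(f b_i)^*]
    represents [f]. *)
Lemma riesz_representation (f : {scalar H}) : exists w, forall x, f x = h x w.
Proof.
pose b := vbasis {:H}; pose n := \dim {:H}.
have /freeP indep : free b by apply: basis_free (vbasisP _).
have expand x : x = \sum_(i < n) coord b i x *: b`_i.
  by apply: coord_vbasis; rewrite memvf.
have gram_lin : linear (fun w => \sum_(i < n) h w b`_i *: b`_i).
  move=> a x y; rewrite scaler_sumr -big_split /=; apply: eq_bigr => i _.
  by rewrite linearPl /= scalerDl scalerA.
pose gram : {linear H -> H} := HB.pack (fun w => \sum_(i < n) h w b`_i *: b`_i)
  (GRing.isLinear.Build C H H *:%R _ gram_lin).
have gram_inj : lker (linfun gram) == 0%VS.
  apply/lker0P => x y; rewrite !lfunE => /eqP; rewrite -subr_eq0 -linearB /=.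
  move=> /eqP sum0; apply/eqP; rewrite -subr_eq0 -(dnorm_eq0 h).
  rewrite [X in h _ X]expand linear_sumr big1 // => i _.
  by rewrite linearZ /= (indep _ sum0) mulr0.
pose v := \sum_(i < n) (f b`_i)^* *: b`_i.
have := memvf v; rewrite -(lker0_limgf gram_inj) => /memv_imgP[w _].
rewrite lfunE /= => /eqP; rewrite eq_sym -subr_eq0 -sumrB.
under eq_bigr do rewrite -scalerBl.
move=> /eqP sum0; exists w => x; rewrite [x]expand linear_sum linear_sumlz.
apply: eq_bigr => i _; rewrite linearZ linearZl_LR /=; congr (_ * _).
rewrite hC; have /eqP := indep _ sum0 i.
by rewrite subr_eq0 => /eqP->; rewrite conjCK.
Qed.

Lemma adjoint_exists (A : 'End(H)) :
  exists B : 'End(H), forall x y, h (A x) y = h x (B y).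
Proof.
pose b := vbasis {:H}; pose n := \dim {:H}.
(* The adjoint is assembled from the Riesz vectors [w i] of the coordinates of [A x]. *)
have /choice[w wE] (i : 'I_n) : exists w, forall x, coord b i (A x) = h x w.
  exact: riesz_representation (coord b i \o A).
have lin_B : linear (fun y => \sum_(i < n) h y b`_i *: w i).
  move=> a x y; rewrite scaler_sumr -big_split /=; apply: eq_bigr => i _.
  by rewrite linearPl /= scalerDl scalerA.
pose B : {linear H -> H} := HB.pack (fun y => \sum_(i < n) h y b`_i *: w i)
  (GRing.isLinear.Build C H H *:%R _ lin_B).
exists (linfun B) => x y; rewrite lfunE /= linear_sumr.
rewrite [A x](coord_vbasis (memvf _)) linear_sumlz.
apply: eq_bigr => i _; rewrite linearZ linearZl_LR /= -hC mulrC.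
by rewrite -wE mulrC.
Qed.

(** The quadratic form at [x] is the squared norm of [\sum_j A j (x j)]. *)
Lemma gram_positive k (A B : 'I_k -> 'End(H)) :
    (forall i x y, h (A i x) y = h x (B i y)) ->
  positive_opmx h (\matrix_(i, j) (B i \o A j)%VF).
Proof.
move=> AB x; pose w := \sum_j A j (x j).
suff -> : \sum_i inner h (x i)
    (\sum_j (\matrix_(i, j) (B i \o A j)%VF) i j (x j)) = h w w.
  exact: dnorm_ge0.
rewrite [RHS]linear_sumr; apply: eq_bigr => i _.
rewrite /inner hC [RHS]hC AB [B i w]linear_sum.
by under eq_bigr do rewrite mxE comp_lfunE.
Qed.

Lemma cp_null_vector (tau : {linear 'End(H) -> 'End(H)}) (u : H)
    (A B : 'End(H)) :
    completely_positive h tau -> tau \1%VF = \1%VF ->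
    (forall x y, h (A x) y = h x (B y)) ->
    inner h u (tau (B \o A)%VF u) = 0 ->
  tau A u = 0 /\ forall x, inner h u (tau B x) = 0.
Proof.
move=> tau_cp tau1 AB null.
pose As (i : 'I_2) := if i == 0 then \1%VF else A.
pose Bs (i : 'I_2) := if i == 0 then \1%VF else B.
have AsBs i x y : h (As i x) y = h x (Bs i y).
  by rewrite /As /Bs; case: eqP => _; rewrite ?id_lfunE.
have both x : h (tau A u) x = 0 /\ h (tau B x) u = 0.
  apply: (affine_ge0_eq0 (a := h x x)) => c.
  (* At the vector [(x, c u)] the [|c|^2] term is the vanishing entry [null], so the form is affine
     in [c] and [c^*]. *)
  have := tau_cp _ _ (gram_positive AsBs) (fun i => if i == 0 then x else c *: u).
  rewrite !big_ord_recl !big_ord0 !mxE /As /Bs /= !comp_lfun1l !comp_lfun1r.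
  rewrite tau1 id_lfunE !addr0 /inner !linearDl.
  rewrite !linearZ /= !linearZl_LR /= [h (tau (B \o A)%VF u) u]null.
  by rewrite !mulr0 addr0 addrA.
split=> [|x]; last by case: (both x).
by apply/eqP; rewrite -(dnorm_eq0 h); case: (both (tau A u)) => ->.
Qed.

End Adjoint.

Section Compression.
Variables (C : numClosedFieldType) (H : vectType C).
Variable h : {dot H for Num.conj}.

Let hC x y : h x y = (h y x)^*.
Proof. by rewrite hermC expr0 mul1r. Qed.

Section Subspace.
Variable V : {vspace H}.

(** The Riesz vector [w] in [V] of [v |-> h v x] leaves [x - w] orthogonal to [V], so it is the
    projection of [x]. *)
Lemma orth_proj_adjoint (x : H) (y : subvs_of V) :
  h x (vsval y) = sub_dot h V (orth_proj h V x) y.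
Proof.
have [w wE] := riesz_representation (sub_dot h V) (applyr h x \o vsval).
have {}wE (v : subvs_of V) : h (vsval v) x = h (vsval v) (vsval w) by exact: wE.
have xw : x - vsval w \in orthov h V.
  apply/mem_orthovP => v vV; rewrite linearBl /= hC [h (vsval w) v]hC -rmorphB.
  by rewrite (wE (Subvs vV)) subrr rmorph0.
have -> : orth_proj h V x = w.
  by rewrite -[x](subrK (vsval w)) linearD /= orth_proj_orthov ?orth_proj_id ?add0r.
by rewrite hC wE -hC.
Qed.

(** Projection and inclusion are mutually adjoint, so both [corner] and the final compression are
    conjugations [X |-> T^* X T], which preserve positivity of operator matrices. *)
Lemma compression_cp (tau : {linear 'End(H) -> 'End(H)}) :
  completely_positive h tau ->
  completely_positive (sub_dot h V) (compression h (V := V) tau).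
Proof.
move=> tau_cp k A A_pos x.
have corner_pos : positive_opmx h (map_mx (corner h (V := V)) A).
  move=> y; have := A_pos (fun i => orth_proj h V (y i)).
  congr (_ <= _); apply: eq_bigr => i _; rewrite /inner !linear_sumlz.
  apply: eq_bigr => j _; rewrite mxE !comp_lfunE [incl V _]lfunE /=.
  by rewrite [RHS]hC orth_proj_adjoint [LHS](hermC (sub_dot h V)) expr0 mul1r !comp_lfunE.
have := tau_cp _ _ corner_pos (fun i => vsval (x i)).
congr (_ <= _); apply: eq_bigr => i _; rewrite /inner !linear_sumlz.
apply: eq_bigr => j _; rewrite !mxE !comp_lfunE [incl V _]lfunE /=.
by rewrite orth_proj_adjoint !comp_lfunE.
Qed.

End Subspace.

Section InvariantState.
Variables (u : H) (tau : {linear 'End(H) -> 'End(H)}).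
Let H0 := orthov h <[u]>%VS.

Lemma corner_state_vector (X : 'End(subvs_of H0)) : corner h X u = 0.
Proof.
apply: corner_orthov; apply/mem_orthovP => v.
by rewrite mem_orthov1 => /eqP vu; rewrite -[LHS]/(h u v) hC vu conjC0.
Qed.

Hypothesis u1 : inner h u u = 1.
Hypothesis tau_cp : completely_positive h tau.
Hypothesis tau1 : tau \1%VF = \1%VF.
Hypothesis tau_inv : forall X : 'End(H), inner h u (tau X u) = inner h u (X u).

Lemma tau_corner (X : 'End(subvs_of H0)) :
  tau (corner h X) = corner h (compression h tau X).
Proof.
have [Z ZE] := adjoint_exists h (corner h X).
have ZE' x y : h (Z x) y = h x (corner h X y) by rewrite hC -ZE -hC.
have Xu := corner_state_vector X.
(* The squared norm of [Z u] is [h u (corner h X (Z u))], and the corner has range in [H0]. *)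
have Zu : Z u = 0.
  apply/eqP; rewrite -(dnorm_eq0 h) ZE' hC.
  have : corner h X (Z u) \in H0 by rewrite 2!comp_lfunE [incl H0 _]lfunE; apply: subvsP.
  by rewrite mem_orthov1 => /eqP zu; rewrite zu conjC0.
have [|tXu _] := cp_null_vector (u := u) tau_cp tau1 ZE.
  by rewrite tau_inv comp_lfunE Xu linear0 /inner linear0l.
(* With the roles of the corner and its adjoint exchanged, the second conclusion says that
   [tau (corner h X)] has range in [H0]. *)
have [|_ utX] := cp_null_vector (u := u) tau_cp tau1 ZE'.
  by rewrite tau_inv comp_lfunE Zu linear0 /inner linear0l.
(* Split [x] into its components along [u], where both sides vanish, and in [H0]. *)
apply/lfunP => x; rewrite -[x](subrK (h x u *: u)).
set y := x - _; have yH0 : y \in H0.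
  by rewrite mem_orthov1 /y linearBl /= linearZl_LR /= [h u u]u1 mulr1 subrr.
suff tXy : tau (corner h X) y = corner h (compression h tau X) y.
  rewrite [LHS]linearD [RHS]linearD; congr (_ + _); first exact: tXy.
  by rewrite [LHS]linearZ [RHS]linearZ /= tXu corner_state_vector.
have -> : y = vsval (Subvs yH0) by [].
rewrite corner_sub 2!comp_lfunE [incl H0 _]lfunE /=.
have tyH0 : tau (corner h X) y \in H0 by rewrite mem_orthov1; apply/eqP/utX.
by have -> : tau (corner h X) y = vsval (Subvs tyH0) by []; rewrite orth_proj_id.
Qed.

End InvariantState.
End Compression.

Lemma nilpotent_of_order_exists (V : zmodType) (f : V -> V) (p : nat) :
  (forall x, iter p f x = 0) -> exists2 q, (q <= p)%N & nilpotent_of_order f q.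
Proof.
move=> fp; pose P r := `[< forall x, iter r f x = 0 >].
have exP : exists r, P r by exists p; apply/asboolP.
case: (ex_minnP exP) => q /asboolP fq minq; exists q; first exact/minq/asboolP.
by split=> // r fr; apply/minq/asboolP.
Qed.

Theorem theorem4p2 (R : realType) (H : vectType R[i])
    (h : {dot H for Num.conj}) (u : H) (hu : inner h u u = 1)
    (p : nat) (hp : (1 <= p)%N)
    (tau : {linear 'End(H) -> 'End(H)})
    (tau_unital : tau \1%VF = \1%VF)
    (tau_cp : completely_positive h tau)
    (tau_p : forall X : 'End(H), iter p tau X = inner h u (X u) *: \1%VF) :
  let H0 : {vspace H} := orthov h <[u]>%VS in
  let alpha : {linear 'End(subvs_of H0) -> 'End(subvs_of H0)} :=
    compression h (V := H0) tau in
  [/\ completely_positive (sub_dot h H0) alpha,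
      exists2 q : nat, (q <= p)%N & nilpotent_of_order alpha q
    & forall X : 'End(subvs_of H0), iter p alpha X = 0].
Proof.
move=> H0 alpha.
have tau_inv (X : 'End(H)) : inner h u (tau X u) = inner h u (X u).
  have : iter p tau (tau X) = tau (iter p tau X) by rewrite -iterSr.
  rewrite !tau_p linearZ /= tau_unital => /(congr1 (fun Y : 'End(H) => Y u)).
  rewrite !scale_lfunE id_lfunE => /(congr1 (h^~ u)).
  by rewrite !linearZl_LR /= [h u u]hu !mulr1.
have corner_iter n X : corner h (iter n alpha X) = iter n tau (corner h X).
  by elim: n => //= n <-; rewrite (tau_corner hu tau_cp).
have alpha_p (X : 'End(subvs_of H0)) : iter p alpha X = 0.
  (* An operator on [H0] is recovered from its corner, so it suffices that [tau^p] kills corners; it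
     does because they annihilate [u]. *)
  apply/lfunP => y; apply: val_inj; rewrite /= -(corner_sub h) corner_iter tau_p.
  by rewrite corner_state_vector /inner linear0l scale0r !lfunE.
by split=> //; [apply: compression_cp | apply: nilpotent_of_order_exists].
Qed.
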